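(* The order type of the set $\{\alpha < \omega_1 \mid \alpha \text{ is a transcendental ordinal}\}$ is $\omega_1$.
   Context: $\oplus$ and $\otimes$ denote Nim-sum and Nim-product of ordinals, defined recursively by $\alpha \oplus \beta = \operatorname{mex}\{\alpha' \oplus \beta, \alpha \oplus \beta' \mid \alpha'<\alpha, \beta'<\beta\}$ and $\alpha \otimes \beta = \operatorname{mex}\{(\alpha' \otimes \beta) \oplus (\alpha \otimes \beta') \oplus (\alpha' \otimes \beta') \mid \alpha'<\alpha, \beta'<\beta\}$, where $\operatorname{mex}(S)$ is the least ordinal not in $S$. With these operations the class of ordinals is a Field of characteristic 2, denoted $\mathrm{On}_2$. An ordinal is identified with the set of smaller ordinals. An ordinal is called transcendental if it is an algebraically closed subfield of $\mathrm{On}_2$. $\omega_1$ is the first uncountable ordinal. *)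

(* Defs.v *)
From HB Require Import structures.
From mathcomp Require Import all_boot all_order.
From mathcomp Require Import all_classical.

Set Implicit Arguments.
Unset Strict Implicit.
Unset Printing Implicit Defensive.

Import Order.TTheory.
Local Open Scope classical_set_scope.
Local Open Scope order_scope.
Local Open Scope quotient_scope.

(** Ordinals are isomorphism classes of well-ordered types; [Ord] lives one
    universe above the carriers, so it plays the role of the class [On]. *)

Record woset := Woset {
  wo_sort :> Type;
  wole : rel wo_sort;
  wole_wo : wochoice.well_order wole }.

HB.instance Definition _ := gen_eqMixin woset.
HB.instance Definition _ := gen_choiceMixin woset.

Section WosetTheory.
Variable A : woset.
Implicit Types x y z : A.

Lemma wole_min (P : A -> Prop) :
  (exists x, P x) -> exists2 z, P z & forall x, P x -> wole z x.
Proof.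
move=> [x Px].
have [|z [[Pz zP] _]] := @wole_wo A (fun x => `[<P x>]).
  by exists x; apply/asboolP.
exists z; first exact/asboolP.
by move=> y Py; apply: zP; apply/asboolP.
Qed.

Lemma wole_refl x : wole x x.
Proof.
have [|z -> zx] := @wole_min (fun y => y = x); first by exists x.
exact: zx.
Qed.

Lemma wole_total x y : wole x y || wole y x.
Proof.
have [|z [->|->] zx] := @wole_min (fun z => z = x \/ z = y).
- by exists x; left.
- by rewrite zx//; right.
- by rewrite [wole y x]zx ?orbT//; left.
Qed.

Lemma wole_anti x y : wole x y -> wole y x -> x = y.
Proof.
move=> xy yx.
have [|z [_ zu]] := @wole_wo A (fun z => `[< z = x \/ z = y >]).
  by exists x; apply/asboolP; left.
have zx : z = x.
  apply: zu; split; first by apply/asboolP; left.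
  by move=> t /asboolP[]->; rewrite ?wole_refl.
rewrite -zx; apply: zu; split; first by apply/asboolP; right.
by move=> t /asboolP[]->; rewrite ?wole_refl.
Qed.

Lemma wole_trans x y z : wole x y -> wole y z -> wole x z.
Proof.
move=> xy yz.
have [|m mE mP] := @wole_min (fun t => [\/ t = x, t = y | t = z]).
  by exists x; constructor.
have mx : wole m x by apply: mP; constructor.
have my : wole m y by apply: mP; constructor.
have mz : wole m z by apply: mP; constructor.
case: mE => mE; move: mx my mz; rewrite mE => mx my mz //.
- by rewrite (wole_anti xy mx).
- by rewrite -(wole_anti yz my).
Qed.

Definition wolt x y := ~~ wole y x.

Lemma woltW x y : wolt x y -> wole x y.
Proof. by move=> /negbTE yx; have := wole_total x y; rewrite yx orbF. Qed.

Lemma wolt_trans x y z : wolt x y -> wolt y z -> wolt x z.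
Proof.
move=> xy yz; apply/negP => zx; move/negP: yz; apply.
exact: wole_trans zx (woltW xy).
Qed.

Lemma wolt_wf : well_founded wolt.
Proof.
move=> x; apply: contrapT => nx.
have [|z nz zP] := @wole_min (fun x => ~ Acc wolt x); first by exists x.
apply: nz; constructor => y yz; apply: contrapT => /zP.
by apply/negP.
Qed.

Lemma wosegment_wo (a : A) :
  wochoice.well_order (fun u v : {x : A | wolt x a} => wole (sval u) (sval v)).
Proof.
move=> S [u Su].
have [|z [h Sz] zP] := @wole_min (fun x => exists h, S (exist _ x h)).
  by case: u Su => x h Sx; exists x, h.
exists (exist _ z h); split.
  by split=> // -[v hv] Sv; apply: zP; exists hv.
move=> [v hv] [Sv vP]; apply: eq_exist; apply: wole_anti.
  by apply: zP; exists hv.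
exact: (vP _ Sz).
Qed.

Definition wosegment (a : A) : woset := Woset (@wosegment_wo a).

Definition insegment (a x : A) (xa : wolt x a) : wosegment a :=
  exist (fun x => wolt x a) x xa.

End WosetTheory.

Definition woiso (A B : woset) : Prop :=
  exists2 f : A -> B, bijective f & {mono f : x y / wole x y}.

Lemma woiso_refl A : woiso A A.
Proof. by exists id => //; exists id. Qed.

Lemma woiso_sym A B : woiso A B -> woiso B A.
Proof.
move=> [f [g fK gK] fm]; exists g; first by exists f.
by move=> x y; rewrite -fm !gK.
Qed.

Lemma woiso_trans B A C : woiso A B -> woiso B C -> woiso A C.
Proof.
move=> [f bf fm] [g bg gm]; exists (g \o f); first exact: bij_comp.
by move=> x y /=; rewrite gm fm.
Qed.

Definition woisob : rel woset := fun A B => `[< woiso A B >].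

Lemma woisob_equiv : equiv_class_of woisob.
Proof.
split=> [A|A B|B A C]; first exact/asboolP/woiso_refl.
  by apply/asboolP/asboolP => /woiso_sym.
by move=> /asboolP AB /asboolP BC; apply/asboolP/(woiso_trans AB).
Qed.

Canonical woisob_equivRel := EquivRelPack woisob_equiv.

Definition Ord := {eq_quot woisob}.

HB.instance Definition _ := Choice.on Ord.
HB.instance Definition _ := EqQuotient.on Ord.

Definition woslt (A B : woset) : Prop := exists b : B, woiso A (wosegment b).

Lemma woiso_segment (A B : woset) (f : A -> B) (a : A) :
    bijective f -> {mono f : x y / wole x y} ->
  woiso (wosegment a) (wosegment (f a)).
Proof.
move=> [g fK gK] fm.
have fP (u : wosegment a) : wolt (f (sval u)) (f a).
  by rewrite /wolt fm; exact: (svalP u).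
have gP (v : wosegment (f a)) : wolt (g (sval v)) a.
  by rewrite /wolt -fm gK; exact: (svalP v).
exists (fun u => insegment (fP u)); last by move=> u v; exact: fm.
exists (fun v => insegment (gP v)).
  by move=> [u hu]; apply: eq_exist; rewrite /= fK.
by move=> [u hu]; apply: eq_exist; rewrite /= gK.
Qed.

Lemma woiso_segment_segment (A : woset) (a : A) (b : wosegment a) :
  woiso (wosegment b) (wosegment (sval b)).
Proof.
have fP (u : wosegment b) : wolt (sval (sval u)) (sval b) := svalP u.
have g1 (v : wosegment (sval b)) : wolt (sval v) a.
  exact: wolt_trans (svalP v) (svalP b).
have g2 (v : wosegment (sval b)) :
  wolt (insegment (g1 v)) b := svalP v.
exists (fun u => insegment (fP u)); last by [].
exists (fun v => insegment (g2 v)).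
  by move=> [[u hu] hu']; do 2 apply: eq_exist => /=.
by move=> [u hu]; apply: eq_exist.
Qed.

Lemma woslt_iso A A' B B' : woiso A A' -> woiso B B' ->
  woslt A B -> woslt A' B'.
Proof.
move=> AA' [f fb fm] [b Ab]; exists (f b).
apply: woiso_trans (woiso_segment b fb fm).
exact: woiso_trans (woiso_sym AA') Ab.
Qed.

Lemma woslt_segment (A : woset) (a b : A) :
  wolt a b -> woslt (wosegment a) (wosegment b).
Proof.
move=> ab; exists (insegment ab).
exact: woiso_sym (woiso_segment_segment (insegment ab)).
Qed.

Lemma woslt_trans B A C : woslt A B -> woslt B C -> woslt A C.
Proof.
move=> [b Ab] [c [f fb fm]]; exists (sval (f b)).
apply: woiso_trans Ab _; apply: woiso_trans (woiso_segment b fb fm) _.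
exact: woiso_segment_segment.
Qed.

Lemma woslt_wf : well_founded woslt.
Proof.
move=> A; constructor => B [a Ba].
elim/(well_founded_ind (@wolt_wf A)): a B Ba => a IH B Ba.
constructor => C [b Cb]; move: Ba => [f fb fm].
apply: (IH (sval (f b))); first exact: (svalP (f b)).
apply: woiso_trans Cb _; apply: woiso_trans (woiso_segment b fb fm) _.
exact: woiso_segment_segment.
Qed.

Lemma woslt_irr A : ~ woslt A A.
Proof.
by elim/(well_founded_ind woslt_wf): A => A IH AA; exact: (IH A AA AA).
Qed.

Lemma woslt_total A B : [\/ woslt A B, woiso A B | woslt B A].
Proof.
elim/(well_founded_ind woslt_wf): A B => A IHA.
elim/(well_founded_ind woslt_wf) => B IHB.
have sA (C : woset) (c : C) : woslt (wosegment c) C.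
  by exists c; exact: woiso_refl.
have [[a [aB|Ba]]|nA] :=
    pselect (exists a : A, woiso (wosegment a) B \/ woslt B (wosegment a)).
- by apply: Or33; exists a; exact: woiso_sym.
- by apply: Or33; apply: woslt_trans Ba (sA _ _).
have [[b [bA|Ab]]|nB] :=
    pselect (exists b : B, woiso A (wosegment b) \/ woslt A (wosegment b)).
- by apply: Or31; exists b.
- by apply: Or31; apply: woslt_trans Ab (sA _ _).
have lA (a : A) : exists b : B, woiso (wosegment a) (wosegment b).
  by have [//| |] := IHA _ (sA _ a) B => h; case: nA; exists a; auto.
have lB (b : B) : exists a : A, woiso (wosegment b) (wosegment a).
  by have [| |//] := IHB _ (sA _ b) => h; case: nB; exists b; auto.
have [f fP] := choice lA; have [g gP] := choice lB.
have sinj (C : woset) (c d : C) : woiso (wosegment c) (wosegment d) -> c = d.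
  move=> cd; apply: wole_anti; apply: contrapT => /negP /woslt_segment h.
    by apply: (@woslt_irr (wosegment c)); apply: woslt_iso h => //;
      [exact: woiso_sym|exact: woiso_refl].
  by apply: (@woslt_irr (wosegment c)); apply: woslt_iso h;
    [exact: woiso_refl|exact: woiso_sym].
have fl x y : wolt x y -> wolt (f x) (f y).
  move=> xy; apply/negP => fyx.
  have h : woslt (wosegment (f x)) (wosegment (f y)).
    by apply: woslt_iso (fP x) (fP y) _; exact: woslt_segment.
  have [yx|/negP] := pselect (wole (f x) (f y)).
    move: h; rewrite (wole_anti fyx yx); exact: woslt_irr.
  by move=> /woslt_segment /(woslt_trans h); exact: woslt_irr.
apply: Or32; exists f.
  exists g => [a|b]; apply: sinj.
    exact: woiso_sym (woiso_trans (fP a) (gP (f a))).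
  exact: woiso_sym (woiso_trans (gP b) (fP (g b))).
move=> x y; case: (boolP (wole x y)) => xy; last exact/negbTE/fl.
have [yx|/negP/fl/woltW//] := pselect (wole y x).
by rewrite (wole_anti xy yx) wole_refl.
Qed.

Definition olt (a b : Ord) : bool := `[< woslt (repr a) (repr b) >].
Definition ole (a b : Ord) : bool := (a == b) || olt a b.

Lemma ord_repr_eq (a b : Ord) : woiso (repr a) (repr b) -> a = b.
Proof.
by move=> h; rewrite -[a]reprK -[b]reprK; apply/eqmodP; exact/asboolP.
Qed.

Lemma repr_pi (A : woset) : woiso (repr (\pi_Ord A)) A.
Proof. by have /eqmodP/asboolP := reprK (\pi_Ord A). Qed.

Lemma olt_pi (A B : woset) : olt (\pi A) (\pi B) <-> woslt A B.
Proof.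
split=> [/asboolP|AB]; first by apply: woslt_iso; exact: repr_pi.
by apply/asboolP; apply: woslt_iso AB; apply: woiso_sym; exact: repr_pi.
Qed.

Lemma olt_irr : irreflexive olt.
Proof. by move=> a; apply/asboolP; exact: woslt_irr. Qed.

Lemma olt_trans : transitive olt.
Proof.
by move=> b a c /asboolP ab /asboolP bc; apply/asboolP/(woslt_trans ab).
Qed.

Lemma ole_total : total ole.
Proof.
move=> a b; have [h|h|h] := woslt_total (repr a) (repr b).
- by apply/orP; left; apply/orP; right; apply/asboolP.
- by rewrite (ord_repr_eq h) /ole eqxx.
- by apply/orP; right; apply/orP; right; apply/asboolP.
Qed.

Lemma olt_def (a b : Ord) : olt a b = (b != a) && ole a b.
Proof.
rewrite /ole; case: eqVneq => [->|] //=; exact: olt_irr.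
Qed.

Lemma ole_refl : reflexive ole. Proof. by move=> a; rewrite /ole eqxx. Qed.

Lemma ole_anti : antisymmetric ole.
Proof.
move=> a b /andP[/orP[/eqP//|ab] /orP[/eqP//|ba]].
by have := olt_trans ab ba; rewrite olt_irr.
Qed.

Lemma ole_trans : transitive ole.
Proof.
move=> b a c /orP[/eqP->//|ab] /orP[/eqP<-|bc].
  by rewrite /ole ab orbT.
by rewrite /ole (olt_trans ab bc) orbT.
Qed.

Fact ord_display : Order.disp_t. Proof. exact: (Order.Disp tt tt). Qed.

HB.instance Definition _ := Order.isPOrder.Build ord_display Ord
  olt_def ole_refl ole_anti ole_trans.
HB.instance Definition _ := Order.POrder_isTotal.Build ord_display Ord ole_total.

Lemma ord_lt_wf : well_founded (fun a b : Ord => a < b).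
Proof.
move=> a.
have [A] : exists A, woiso A (repr a) by exists (repr a); exact: woiso_refl.
elim/(well_founded_ind woslt_wf): A a => A IH a Aa.
constructor => b /asboolP ba; apply: (IH (repr b)); last exact: woiso_refl.
by apply: woslt_iso ba; [exact: woiso_refl | exact: woiso_sym].
Qed.

Lemma ord_FixE (P : Ord -> Type) (F : forall a, (forall b, b < a -> P b) -> P a) a :
  Fix ord_lt_wf P F a = F a (fun b _ => Fix ord_lt_wf P F b).
Proof.
apply: Fix_eq => x f g fg; congr (F x).
by apply: functional_extensionality_dep => y;
  apply: functional_extensionality_dep => h.
Qed.

Lemma void_wo : wochoice.well_order (fun _ _ : void => true).
Proof. by move=> S [[]]. Qed.

Definition ord0 : Ord := \pi_Ord (Woset void_wo).

(** The junk value [ord0] is returned when [P] is empty. *)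
Definition least (P : set Ord) : Ord :=
  xget ord0 [set a | P a /\ forall b, P b -> a <= b].

Lemma leastP (P : set Ord) : P !=set0 ->
  P (least P) /\ forall b, P b -> least P <= b.
Proof.
move=> [a Pa]; rewrite /least.
suff : [set a | P a /\ forall b, P b -> a <= b] !=set0 by exact: xgetPex.
elim/(well_founded_ind ord_lt_wf): a Pa => a IH Pa.
have [[b Pb ba]|nb] := pselect (exists2 b, P b & b < a); first exact: IH Pb.
exists a; split=> // b Pb; rewrite leNgt; apply/negP => ba.
by apply: nb; exists b.
Qed.

(** [ord0] is only an honest value when [S] is not all of [Ord]; this is
    automatic for the set-sized [S] below. *)
Definition mex (S : set Ord) : Ord := least (~` S).

Definition ord1 : Ord := mex [set ord0].

Definition below (a : Ord) : set Ord := [set b | b < a].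

Definition nim_add : Ord -> Ord -> Ord :=
  Fix ord_lt_wf (fun _ => Ord -> Ord) (fun a addl =>
    Fix ord_lt_wf (fun _ => Ord) (fun b addr =>
      mex ([set c | exists a' (h : a' < a), c = addl a' h b] `|`
           [set c | exists b' (h : b' < b), c = addr b' h]))).

Lemma nim_addE a b : nim_add a b =
  mex ([set nim_add a' b | a' in below a] `|`
       [set nim_add a b' | b' in below b]).
Proof.
rewrite {1}/nim_add !ord_FixE -/nim_add; congr mex.
have addE a' b' : Fix ord_lt_wf (fun _ => Ord) (fun b addr =>
    mex ([set c | exists a'' (h : a'' < a'), c = nim_add a'' b] `|`
         [set c | exists b' (h : b' < b), c = addr b' h])) b' = nim_add a' b'.
  by rewrite /nim_add [in RHS]ord_FixE.
apply/seteqP; split=> c /= -[].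
- by move=> [a' [h ->]]; left; exists a'.
- by move=> [b' [h ->]]; right; exists b' => //; rewrite addE.
- by move=> [a' h <-]; left; exists a', h.
- by move=> [b' h <-]; right; exists b', h; rewrite addE.
Qed.

Definition nim_mul : Ord -> Ord -> Ord :=
  Fix ord_lt_wf (fun _ => Ord -> Ord) (fun a mull =>
    Fix ord_lt_wf (fun _ => Ord) (fun b mulr =>
      mex [set c | exists a' (ha : a' < a) b' (hb : b' < b),
        c = nim_add (nim_add (mull a' ha b) (mulr b' hb)) (mull a' ha b')])).

Lemma nim_mulE a b : nim_mul a b =
  mex [set nim_add (nim_add (nim_mul a' b) (nim_mul a b')) (nim_mul a' b')
      | a' in below a & b' in below b].
Proof.
rewrite {1}/nim_mul !ord_FixE -/nim_mul; congr mex.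
have mulE a' b' : Fix ord_lt_wf (fun _ => Ord) (fun b mulr =>
    mex [set c | exists a'' (ha : a'' < a') b' (hb : b' < b),
      c = nim_add (nim_add (nim_mul a'' b) (mulr b' hb)) (nim_mul a'' b')]) b'
    = nim_mul a' b'.
  by rewrite /nim_mul [in RHS]ord_FixE.
apply/seteqP; split=> c /=.
- by move=> [a' [ha [b' [hb ->]]]]; exists a' => //; exists b' => //; rewrite mulE.
- by move=> [a' ha [b' hb <-]]; exists a', ha, b', hb; rewrite mulE.
Qed.

Definition nim_exp (x : Ord) (n : nat) : Ord := iter n (nim_mul x) ord1.

Definition nim_eval (n : nat) (c : nat -> Ord) (x : Ord) : Ord :=
  \big[nim_add/ord0]_(i < n.+1) nim_mul (c i) (nim_exp x i).

Definition nim_subfield (K : set Ord) : Prop :=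
  [/\ K ord0 /\ K ord1,
      forall x y, K x -> K y -> K (nim_add x y),
      forall x y, K x -> K y -> K (nim_mul x y),
      forall x, K x -> exists2 y, K y & nim_add x y = ord0
    & forall x, K x -> x != ord0 -> exists2 y, K y & nim_mul x y = ord1].

Definition nim_closed (K : set Ord) : Prop :=
  forall (n : nat) (c : nat -> Ord), (0 < n)%N ->
    (forall i, (i <= n)%N -> K (c i)) -> c n != ord0 ->
    exists2 x, K x & nim_eval n c x = ord0.

Definition transcendental (a : Ord) : Prop :=
  nim_subfield (below a) /\ nim_closed (below a).

Definition omega1 : Ord := least [set a | ~ countable (below a)].

Lemma omega1_spec : ~ countable (below omega1) /\
  forall a, ~ countable (below a) -> omega1 <= a.
Proof.
apply: leastP.
have [R Rwo] := wochoice.well_ordering_principle {classic (nat -> Prop)}.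
pose W := @Woset (nat -> Prop) R Rwo.
exists (\pi_Ord W) => /= cW.
pose f (w : W) : Ord := \pi_Ord (wosegment w).
have fW w : below (\pi_Ord W) (f w).
  by apply/olt_pi; exists w; exact: woiso_refl.
have finj : injective f.
  move=> u v /eqmodP/asboolP uv; apply: wole_anti; apply: contrapT => /negP h.
    by apply: (@woslt_irr (wosegment u)); apply: woslt_iso (woslt_segment h) => //;
      [exact: woiso_sym|exact: woiso_refl].
  by apply: (@woslt_irr (wosegment u)); apply: woslt_iso (woslt_segment h);
    [exact: woiso_refl|exact: woiso_sym].
move/pcard_leP : cW => [g].
have hinj : injective (g \o f).
  move=> u v /= h; apply: finj.
  by apply: (@inj _ _ _ g) => //; apply/mem_set; exact: fW.
pose D : nat -> Prop := fun n => exists A : nat -> Prop, n = (g \o f) A /\ ~ A n.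
have [Dn|nDn] := pselect (D (g (f D))).
  by have [A [/hinj AD nA]] := Dn; apply: nA; rewrite -[X in X _]AD.
by apply: (nDn); exists D.
Qed.

Definition has_order_type (S : set Ord) (a : Ord) : Prop :=
  exists2 f : Ord -> Ord, set_bij (below a) S f &
    forall b c, below a b -> below a c -> (f b < f c) = (b < c).

(* Main.v *)
From HB Require Import structures.
From mathcomp Require Import all_boot all_order all_algebra.
From mathcomp Require Import all_classical.
Require Import Defs.

(** An unbounded subset of [omega1] has order type [omega1], because the
    enumeration of its elements cannot stop at a countable stage; so it suffices
    to find transcendental ordinals above any [b < omega1].

    Suppose that [D], as a set of ordinals, is a subring of [On_2], and that no
    nonzero polynomial over [D] vanishes at [D]. Then [D] is transcendental: this
    is the part of Conway's simplest extension theorem that is needed here. For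
    algebraic closure, the product rule gives that every ordinal [w < D^n] has
    the form [D^n - \prod_(i < n) (D - d_i)] with [d_i < D], and it follows that
    the values at [D] of the polynomials over [D] of degree less than [n] form an
    initial segment of [On]. Let [f] be monic of degree [n > 0] over [D], and put
    [u = D^n - f(D)]. If [D^n <= u] then [D^n] is the value of a polynomial of
    smaller degree, which was excluded. Otherwise
    [f(D) = \prod_i (D - d_i)], hence [f = \prod_i ('X - d_i)] has a root in [D].

    Closing [b] countably often under sums, products and the (finitely many)
    roots in [omega1] of polynomials yields such a [D] with [b <= D < omega1]:
    a nonzero polynomial over [D] vanishing at [D] would have made [D] one of the
    roots added. *)

Import Order.TTheory GRing.Theory.
Local Open Scope classical_set_scope.
Local Open Scope quotient_scope.
Local Open Scope order_scope.

Local Infix "⊕" := nim_add (at level 50, left associativity).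
Local Infix "⊗" := nim_mul (at level 40, left associativity).

(** * Nim addition *)

Lemma ord_ind (P : Ord -> Prop) :
  (forall a, (forall b, b < a -> P b) -> P a) -> forall a, P a.
Proof. exact: (well_founded_ind ord_lt_wf). Qed.

Lemma ord0_le (a : Ord) : ord0 <= a.
Proof.
rewrite leNgt; apply/negP => /asboolP h.
have [[]] : woslt (repr a) (Woset void_wo).
by apply: woslt_iso h; [exact: woiso_refl | exact: repr_pi].
Qed.

Lemma ord0_gt (a : Ord) : (ord0 < a) = (a != ord0).
Proof. by rewrite lt_neqAle ord0_le andbT eq_sym. Qed.

Lemma ltord0 (a : Ord) : (a < ord0) = false.
Proof. by rewrite ltNge ord0_le. Qed.

Lemma below_repr (a b : Ord) :
  b < a -> exists w : repr a, b = \pi_Ord (wosegment w).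
Proof.
move=> /asboolP[w bw]; exists w; apply: ord_repr_eq.
exact: woiso_trans bw (woiso_sym (repr_pi _)).
Qed.

Lemma mono_ge (P : set Ord) (f : Ord -> Ord) :
  (forall a, P a -> P (f a)) ->
  (forall a b, P a -> P b -> a < b -> f a < f b) -> forall a, P a -> a <= f a.
Proof.
move=> Pf fm; elim/ord_ind => a IH Pa; rewrite leNgt; apply/negP => fa.
have := IH _ fa (Pf _ Pa); rewrite leNgt => /negP; apply.
by apply: fm => //; exact: Pf.
Qed.

(* Burali-Forti: a surjection from [I] would well-order a subset of [I] in a
   type longer than every ordinal. *)
Lemma small_proper (I : Type) (F : I -> Ord) : exists a, forall i, F i <> a.
Proof.
apply: contrapT => nF.
have Fsurj a : exists i, F i = a.
  apply: contrapT => na; apply: nF; exists a => i Fi.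
  by apply: na; exists i.
have [g gK] := choice Fsurj.
pose J := {i : I | g (F i) = i}.
have Jwo : wochoice.well_order (fun i j : J => F (sval i) <= F (sval j)).
  move=> S [i Si].
  have [[j [Sj ja]] jmin] :=
    @leastP [set a | exists j : J, S j /\ F (sval j) = a]
      (ex_intro _ _ (ex_intro _ i (conj Si erefl))).
  exists j; split; first by split=> // k Sk; rewrite ja; apply: jmin; exists k.
  move=> k [Sk kmin]; case: j Sj ja kmin jmin => [j hj] Sj ja kmin jmin.
  have kj : F (sval k) = F j.
    apply/eqP; rewrite eq_le (kmin _ Sj) /=; move: ja => /= ->.
    by apply: jmin; exists k.
  case: k Sk kmin kj => [k hk] /= Sk kmin kj; apply: eq_exist.
  by rewrite -hk -hj kj.
pose W := Woset Jwo.
have gP a : g (F (g a)) = g a by rewrite gK.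
pose h a : W := exist _ (g a) (gP a).
pose f a : Ord := (\pi_Ord (wosegment (h a))).
have fW a : f a < (\pi_Ord W).
  by apply/olt_pi; exists (h a); exact: woiso_refl.
have fm a b : setT a -> setT b -> a < b -> f a < f b.
  move=> _ _ ab; apply/olt_pi/woslt_segment.
  by rewrite /wolt /= !gK -ltNge.
(* [f] is increasing, so [a <= f a] for every [a]. At the order type of [W] this contradicts
   [f a < \pi_Ord W]. *)
have := fW (\pi_Ord W); rewrite ltNge => /negP; apply.
exact: (@mono_ge setT).
Qed.

Lemma mexP (S : set Ord) : ~` S !=set0 ->
  ~ S (mex S) /\ forall c, c < mex S -> S c.
Proof.
move=> /leastP[nS minS]; split=> // c; rewrite ltNge => /negP nc.
by apply: contrapT => /minS.
Qed.

Lemma nim_addP a b :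
  [/\ forall a', a' < a -> a' ⊕ b <> a ⊕ b,
      forall b', b' < b -> a ⊕ b' <> a ⊕ b
    & forall c, c < a ⊕ b -> (exists2 a', a' < a & c = a' ⊕ b) \/
                             (exists2 b', b' < b & c = a ⊕ b')].
Proof.
rewrite (nim_addE a b); set S := (_ `|` _)%classic.
have [|nS Slt] := @mexP S.
  (* The options are indexed by a type in the universe of the carriers, so [small_proper] provides
     an ordinal outside [S] and the [mex] is not a junk value. *)
  pose F (x : repr a + repr b) := match x with
    | inl u => (\pi_Ord (wosegment u)) ⊕ b
    | inr v => a ⊕ (\pi_Ord (wosegment v)) end.
  have [c cF] := small_proper _ F; exists c => -[[x xa xc]|[x xb xc]].
    have [u xu] := below_repr _ _ xa.
    by apply: (cF (inl u)); rewrite /= -xu.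
  have [v xv] := below_repr _ _ xb.
  by apply: (cF (inr v)); rewrite /= -xv.
split=> [a' h e|b' h e|c /Slt].
- by apply: nS; rewrite -e; left; exists a'.
- by apply: nS; rewrite -e; right; exists b'.
by move=> [[x xa <-]|[x xb <-]]; [left|right]; exists x.
Qed.

Lemma nim_addI a : injective (nim_add a).
Proof.
move=> b c bc; have [cb|cb|//] := ltgtP c b.
  by have [_ /(_ _ cb)] := nim_addP a b; rewrite bc.
by have [_ /(_ _ cb)] := nim_addP a c; rewrite bc.
Qed.

Lemma nim_addC : commutative nim_add.
Proof.
elim/ord_ind => a IHa; elim/ord_ind => b IHb.
rewrite !nim_addE setUC; congr (mex (_ `|` _)%classic); apply: eq_imagel => x xab.
  by rewrite IHb.
by rewrite IHa.
Qed.

(** If the sides differ, the smaller one is an option of the larger, obtained by lowering [a], [b]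
    or [c]. The induction hypothesis rebrackets this option, and cancellation identifies the lowered
    argument with the original one. *)
Lemma nim_addA : associative nim_add.
Proof.
elim/ord_ind => a IHa; elim/ord_ind => b IHb; elim/ord_ind => c IHc.
have Ir x y z : y ⊕ x = z ⊕ x -> y = z.
  by rewrite ![_ ⊕ x]nim_addC => /nim_addI.
have [lt|lt|//] := ltgtP (a ⊕ (b ⊕ c)) (a ⊕ b ⊕ c); exfalso.
  have [_ _ /(_ _ lt)[[w wab]|[c' c'c]]] := nim_addP (a ⊕ b) c; last first.
    by rewrite -IHc// => /nim_addI/nim_addI e; move: c'c; rewrite e ltxx.
  have [_ _ /(_ _ wab)[[a' a'a ->]|[b' b'b ->]]] := nim_addP a b.
    by rewrite -IHa// => /Ir e; move: a'a; rewrite e ltxx.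
  by rewrite -IHb// => /nim_addI/Ir e; move: b'b; rewrite e ltxx.
have [_ _ /(_ _ lt)[[a' a'a]|[w wbc]]] := nim_addP a (b ⊕ c).
  by rewrite IHa// => /Ir/Ir e; move: a'a; rewrite e ltxx.
have [_ _ /(_ _ wbc)[[b' b'b ->]|[c' c'c ->]]] := nim_addP b c.
  by rewrite IHb// => /Ir/nim_addI e; move: b'b; rewrite e ltxx.
by rewrite IHc// => /nim_addI e; move: c'c; rewrite e ltxx.
Qed.

Lemma nim_add0 : left_id ord0 nim_add.
Proof.
elim/ord_ind => b IH; have [_ ne lt] := nim_addP ord0 b.
have [l|l|//] := ltgtP (ord0 ⊕ b) b; first by have := ne _ l; rewrite IH.
have [[x]|[x xb]] := lt _ l; first by rewrite ltord0.
by rewrite IH// => e; move: xb; rewrite -e ltxx.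
Qed.

Lemma nim_addN : left_inverse ord0 id nim_add.
Proof.
elim/ord_ind => a IH; apply/eqP; rewrite -[_ == _]negbK -ord0_gt.
apply/negP => l; have [_ _ /(_ _ l)] := nim_addP a a.
by move=> [[x xa]|[x xa]]; rewrite -(IH _ xa) ?[a ⊕ x]nim_addC => /nim_addI e;
  move: xa; rewrite e ltxx.
Qed.

HB.instance Definition _ :=
  GRing.isZmodule.Build Ord nim_addA nim_addC nim_add0 nim_addN.

Lemma ord0E : ord0 = 0%R. Proof. by []. Qed.
Lemma nim_addrE a b : a ⊕ b = (a + b)%R. Proof. by []. Qed.

(** * Nim multiplication *)

Lemma ord_addrr (a : Ord) : (a + a = 0)%R.
Proof. exact: nim_addN. Qed.

Lemma ord_addKr (a b : Ord) : (a + (a + b) = b)%R.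
Proof. by rewrite addrA ord_addrr add0r. Qed.

Lemma ord_oppr (a : Ord) : (- a = a)%R.
Proof. by []. Qed.

Lemma ord_addr_eq0 (a b : Ord) : (a + b = 0)%R -> a = b.
Proof. by move=> /eqP; rewrite -[X in (_ + X)%R]ord_oppr subr_eq0 => /eqP. Qed.

(* Proves [s = 0] for a sum [s] in which every term occurs an even number of
   times. *)
Ltac pair_off :=
  rewrite -?addrA;
  repeat match goal with
  | |- (?t + ?t)%R = _ => exact: ord_addrr
  | |- (?t + (?t + _))%R = _ => rewrite ord_addKr
  | |- (?t + ?x)%R = _ =>
    match x with
    | context [(?y + (t + ?z))%R] => rewrite (addrCA y t z)
    | context [(?y + t)%R] => rewrite (addrC y t)
    end
  end.

Lemma nim_mulP a b :
  (forall a' b', a' < a -> b' < b ->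
     (a' ⊗ b + a ⊗ b' + a' ⊗ b')%R <> a ⊗ b) /\
  (forall c, c < a ⊗ b -> exists a' b',
     [/\ a' < a, b' < b & c = (a' ⊗ b + a ⊗ b' + a' ⊗ b')%R]).
Proof.
rewrite (nim_mulE a b); set S := (X in mex X).
have [|nS Slt] := @mexP S.
  pose F (x : repr a * repr b) :=
    let a' := \pi_Ord (wosegment x.1) in let b' := \pi_Ord (wosegment x.2) in
    (a' ⊗ b + a ⊗ b' + a' ⊗ b')%R.
  have [c cF] := small_proper _ F; exists c => -[x xa [y yb xyc]].
  have [u xu] := below_repr _ _ xa; have [v yv] := below_repr _ _ yb.
  by apply: (cF (u, v)); rewrite /F /= -xu -yv.
split=> [a' b' ha hb e|c /Slt].
  by apply: nS; rewrite -e; exists a' => //; exists b'.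
by move=> [x xa [y yb <-]]; exists x, y.
Qed.

(* Over a ring this is [(a + a') * (b + b') != 0]. *)
Lemma nim_rect a a' b b' : a <> a' -> b <> b' ->
  (a ⊗ b + a ⊗ b' + a' ⊗ b + a' ⊗ b' <> 0)%R.
Proof.
have lt_rect x x' y y' : x' < x -> y' < y ->
    (x ⊗ y + x ⊗ y' + x' ⊗ y + x' ⊗ y' <> 0)%R.
  move=> hx hy e; have [/(_ _ _ hx hy) ne _] := nim_mulP x y; apply: ne.
  by apply/esym/ord_addr_eq0; rewrite -[RHS]e; apply: ord_addr_eq0; pair_off.
have [la|la|//] := ltgtP a a'; have [lb|lb|//] := ltgtP b b' => _ _ e.
all: by apply: (lt_rect _ _ _ _ la lb); rewrite -[RHS]e; apply: ord_addr_eq0;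
  pair_off.
Qed.

Lemma nim_mulC : commutative nim_mul.
Proof.
elim/ord_ind => a IHa; elim/ord_ind => b IHb.
rewrite !nim_mulE; congr mex; apply/seteqP; split=> c /=.
  move=> [x xa [y yb <-]]; exists y => //; exists x => //.
  by rewrite (IHa x xa b) (IHb y yb) (IHa x xa y) (nim_addC (b ⊗ x)).
move=> [y yb [x xa <-]]; exists x => //; exists y => //.
by rewrite (IHa x xa b) (IHb y yb) (IHa x xa y) (nim_addC (b ⊗ x)).
Qed.

Lemma nim_mul0 b : ord0 ⊗ b = ord0.
Proof.
apply/eqP; rewrite -[_ == _]negbK -ord0_gt; apply/negP => l.
by have [_ /(_ _ l)[a' [b' []]]] := nim_mulP ord0 b; rewrite ltord0.
Qed.

Lemma ltord1 a : (a < ord1) = (a == ord0).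
Proof.
have [|n0 lt1] := @mexP [set ord0].
  by have [b bP] := small_proper unit (fun=> ord0); exists b => /= /esym; exact: bP tt.
apply/idP/eqP => [/lt1//|->].
by rewrite ord0_gt; apply/eqP.
Qed.

Lemma ord1_neq0 : ord1 != ord0.
Proof. by rewrite -ord0_gt ltord1. Qed.

Lemma nim_mul1 : left_id ord1 nim_mul.
Proof.
elim/ord_ind => b IH; have [ne lt] := nim_mulP ord1 b.
have E b' : b' < b -> (ord0 ⊗ b + ord1 ⊗ b' + ord0 ⊗ b')%R = b'.
  by move=> b'b; rewrite !nim_mul0 ord0E add0r addr0 IH.
have [l|l|//] := ltgtP (ord1 ⊗ b) b.
  by have := ne ord0 _ _ l; rewrite E// ltord1 eqxx => /(_ erefl).
have [x [y [+ yb]]] := lt _ l; rewrite ltord1 => /eqP ->; rewrite E// => e.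
by move: yb; rewrite e ltxx.
Qed.

(** If the sides differ, the smaller one is an option of the larger. Expanded by induction, this
    equation makes a rectangle sum vanish, against [nim_rect]. *)
Lemma nim_mulDl : left_distributive nim_mul +%R.
Proof.
elim/ord_ind => a IHa; elim/ord_ind => b IHb; elim/ord_ind => c IHc.
have neq x y : x < y -> y <> x by move=> h e; move: h; rewrite e ltxx.
have [l|l|//] := ltgtP ((a + b)%R ⊗ c) (a ⊗ c + b ⊗ c)%R; exfalso.
  have [_ _ /(_ _ l)[[w lw]|[w lw]]] := nim_addP (a ⊗ c) (b ⊗ c).
    have [_ /(_ _ lw)[a' [c' [ha hc ->]]]] := nim_mulP a c.
    rewrite nim_addrE => e.
    apply: (@nim_rect (a + b)%R (a' + b)%R c c'); last 2 first.
    - exact: neq.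
    - rewrite e (IHc _ hc) (IHa _ ha) (IHa _ ha); pair_off.
    by move=> /addIr; exact: neq.
  have [_ /(_ _ lw)[b' [c' [hb hc ->]]]] := nim_mulP b c.
  rewrite nim_addrE => e.
  apply: (@nim_rect (a + b)%R (a + b')%R c c'); last 2 first.
  - exact: neq.
  - rewrite e (IHc _ hc) (IHb _ hb) (IHb _ hb); pair_off.
  by move=> /addrI; exact: neq.
have [_ /(_ _ l)[s [c' [ls hc]]]] := nim_mulP (a + b)%R c.
have [_ _ /(_ _ ls)[[a' ha ->]|[b' hb ->]]] := nim_addP a b.
  rewrite nim_addrE (IHc _ hc) (IHa _ ha) (IHa _ ha) => e.
  apply: (@nim_rect a a' c c'); [exact: neq|exact: neq|].
  rewrite -[RHS](ord_addrr (a ⊗ c + b ⊗ c)%R) {2}e; apply: ord_addr_eq0; pair_off.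
rewrite nim_addrE (IHc _ hc) (IHb _ hb) (IHb _ hb) => e.
apply: (@nim_rect b b' c c'); [exact: neq|exact: neq|].
rewrite -[RHS](ord_addrr (a ⊗ c + b ⊗ c)%R) {2}e; apply: ord_addr_eq0; pair_off.
Qed.

Lemma nim_mulDr : right_distributive nim_mul +%R.
Proof. by move=> a b c; rewrite ![a ⊗ _]nim_mulC nim_mulDl. Qed.

Lemma nim_mul_eq0 a b : a ⊗ b = ord0 -> a = ord0 \/ b = ord0.
Proof.
move=> ab; have [->|/eqP a0] := eqVneq a ord0; first by left.
have [->|/eqP b0] := eqVneq b ord0; first by right.
have [] := nim_rect _ _ _ _ a0 b0.
by rewrite !(nim_mulC _ ord0) !nim_mul0 ab ord0E !addr0.
Qed.

(** If the sides differ, some [a' < a], [b' < b], [c' < c] express the smaller as a sum of the seven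
    other triple products, whose bracketing is free by induction. Then [a + a'], [b + b'], [c + c']
    have product zero, although none of them is zero. *)
Lemma nim_mulA : associative nim_mul.
Proof.
elim/ord_ind => a IHa; elim/ord_ind => b IHb; elim/ord_ind => c IHc.
have neq (x y : Ord) : x < y -> (y + x)%R <> ord0.
  by move=> h /ord_addr_eq0 e; move: h; rewrite e ltxx.
have [l|l|//] := ltgtP (a ⊗ (b ⊗ c)) ((a ⊗ b) ⊗ c); exfalso.
  have [_ /(_ _ l)[w [c' [lw hc]]]] := nim_mulP (a ⊗ b) c.
  have [_ /(_ _ lw)[a' [b' [ha hb ->]]]] := nim_mulP a b.
  rewrite !nim_mulDl -?(IHa _ ha) -?(IHb _ hb) -?(IHc _ hc) => e.
  have : (a + a')%R ⊗ ((b + b')%R ⊗ (c + c')%R) = ord0.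
    by rewrite !(nim_mulDl, nim_mulDr) e ord0E; pair_off.
  by move=> /nim_mul_eq0[|/nim_mul_eq0[]]; exact: neq.
have [_ /(_ _ l)[a' [w [ha lw]]]] := nim_mulP a (b ⊗ c).
have [_ /(_ _ lw)[b' [c' [hb hc ->]]]] := nim_mulP b c.
rewrite !nim_mulDr ?(IHa _ ha) ?(IHb _ hb) ?(IHc _ hc) => e.
have : (a + a')%R ⊗ (b + b')%R ⊗ (c + c')%R = ord0.
  by rewrite !(nim_mulDl, nim_mulDr) e ord0E; pair_off.
by move=> /nim_mul_eq0[/nim_mul_eq0[]|]; exact: neq.
Qed.

HB.instance Definition _ := GRing.Zmodule_isComNzRing.Build Ord
  nim_mulA nim_mulC nim_mul1 nim_mulDl ord1_neq0.

Lemma ord_mulf_eq0 (a b : Ord) : (a * b = 0)%R -> a = 0%R \/ b = 0%R.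
Proof. exact: nim_mul_eq0. Qed.

Lemma nim_expE (x : Ord) n : nim_exp x n = (x ^+ n)%R.
Proof. by elim: n => //= n; rewrite exprS => <-. Qed.

Lemma nim_evalE n c x : nim_eval n c x = ((\poly_(i < n.+1) c i).[x])%R.
Proof.
by rewrite horner_poly /nim_eval; apply: eq_bigr => i _; rewrite nim_expE.
Qed.

(** * The simplest extension theorem *)

Lemma nim_mulrE (a b : Ord) : a ⊗ b = (a * b)%R. Proof. by []. Qed.

(* The detour through [⊕] and [⊗] makes all the inferred algebraic structures
   syntactically equal. *)
Ltac ring_pair_off :=
  rewrite -?nim_mulrE -?nim_addrE ?nim_addrE; pair_off.

Lemma lt_mul_ord (a b c : Ord) : c < (a * b)%R -> exists a' b',
  [/\ a' < a, b' < b & c = (a' * b + a * b' + a' * b')%R].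
Proof. by have [_] := nim_mulP a b; apply. Qed.

Lemma lt_add_ord (a b c : Ord) : c < (a + b)%R ->
  (exists2 a', a' < a & c = (a' + b)%R) \/
  (exists2 b', b' < b & c = (a + b')%R).
Proof. by have [_ _] := nim_addP a b; apply. Qed.

Lemma ord_lt1 (a : Ord) : (a < 1%R) = (a == 0%R).
Proof. exact: ltord1. Qed.

Lemma ord_gt0 (a : Ord) : ((0 : Ord)%R < a) = (a != 0%R).
Proof. exact: ord0_gt. Qed.

Section SimplestExtension.
Variable D : Ord.
Hypothesis D1 : (1 : Ord)%R < D.
Hypothesis DD : forall x y : Ord, x < D -> y < D -> (x + y)%R < D.
Hypothesis DM : forall x y : Ord, x < D -> y < D -> (x * y)%R < D.

Definition coefs_below (p : {poly Ord}) := forall i, (p`_i)%R < D.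

Let D0 : (0 : Ord)%R < D.
Proof. by apply: lt_trans D1; rewrite ord_gt0; exact: ord1_neq0. Qed.

Lemma coefs_belowD p q :
  coefs_below p -> coefs_below q -> coefs_below (p + q)%R.
Proof. by move=> hp hq i; rewrite coefD; exact: DD. Qed.

Lemma coefs_belowB p q :
  coefs_below p -> coefs_below q -> coefs_below (p - q)%R.
Proof. by move=> hp hq i; rewrite coefB ord_oppr; exact: DD. Qed.

Lemma coefs_belowZ c p : c < D -> coefs_below p -> coefs_below (c *: p)%R.
Proof. by move=> hc hp i; rewrite coefZ; exact: DM. Qed.

Lemma coefs_belowXn n : coefs_below ('X^n)%R.
Proof. by move=> i; rewrite coefXn; case: (i == n); rewrite ?mulr1n ?mulr0n. Qed.

Lemma coefs_below_prod s : (forall d : Ord, d \in s -> d < D) ->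
  coefs_below (\prod_(d <- s) ('X - d%:P))%R.
Proof.
elim: s => [|d s IH] hs.
  by rewrite big_nil => i; rewrite coef1; case: (i == 0)%N; rewrite ?mulr1n ?mulr0n.
have hp := IH (fun x xs => hs x (@mem_behead _ (d :: s) x xs)).
rewrite big_cons mulrBl mulrC mul_polyC; apply: coefs_belowB.
  by move=> i; rewrite coefMX; case: (i == 0)%N.
by apply: coefs_belowZ => //; apply: hs; rewrite mem_head.
Qed.

(** An option of [D * D ^+ n] given by [d < D] and [v < D ^+ n] differs from [D ^+ n.+1] by
    [(D - d) * (D ^+ n - v)], and induction factors the second term. *)
Lemma lt_exp_prod n w : w < (D ^+ n)%R -> exists s : seq Ord,
  [/\ size s = n, forall d : Ord, d \in s -> d < D
    & (D ^+ n + w = (\prod_(d <- s) ('X - d%:P)).[D])%R].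
Proof.
elim: n w => [|n IH] w.
  rewrite expr0 ord_lt1 => /eqP ->; exists [::].
  by split=> //; rewrite big_nil hornerC addr0.
rewrite exprS => /lt_mul_ord[d [v [dD /IH[s [ss sD sE]] ->]]].
exists (d :: s); split; first by rewrite /= ss.
  by move=> x; rewrite inE => /predU1P[->|/sD].
rewrite big_cons hornerM hornerXsubC -sE ord_oppr !(mulrDl, mulrDr).
by apply: ord_addr_eq0; ring_pair_off.
Qed.

Definition poly_values n : set Ord :=
  [set u | exists p : {poly Ord}, [/\ (size p <= n)%N, coefs_below p & (u = p.[D])%R]].

Lemma poly_valuesS n u : poly_values n u -> poly_values n.+1 u.
Proof. by move=> [p [sp pD ->]]; exists p; split=> //; exact: leqW. Qed.

Lemma poly_valuesD n u v :
  poly_values n u -> poly_values n v -> poly_values n (u + v)%R.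
Proof.
move=> [p [sp pD ->]] [q [sq qD ->]]; exists (p + q)%R; rewrite hornerD.
split=> //; last exact: coefs_belowD.
by rewrite (leq_trans (size_polyD _ _))// geq_max sp.
Qed.

Lemma poly_valuesZ n c u :
  c < D -> poly_values n u -> poly_values n (c * u)%R.
Proof.
move=> cD [p [sp pD ->]]; exists (c *: p)%R; rewrite hornerZ.
split=> //; last exact: coefs_belowZ.
exact: leq_trans (size_scale_leq _ _) sp.
Qed.

Lemma poly_values_exp n : poly_values n.+1 (D ^+ n)%R.
Proof.
by exists ('X^n)%R; rewrite size_polyXn hornerXn; split=> //; exact: coefs_belowXn.
Qed.

Lemma poly_values_monic n f : f \is monic -> size f = n.+1 ->
  coefs_below f -> poly_values n (f.[D] - D ^+ n)%R.
Proof.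
move=> fm fs fD; exists (f - 'X^n)%R; rewrite hornerD hornerN hornerXn.
split=> //; last exact: coefs_belowB (coefs_belowXn n).
apply/leq_sizeP => j; rewrite leq_eqVlt => /predU1P[<-|nj].
  rewrite coefB coefXn eqxx; move: fm; rewrite monicE lead_coefE fs => /eqP /= ->.
  by rewrite subrr.
by rewrite coefB coefXn gtn_eqF// subr0 nth_default// fs.
Qed.

Lemma poly_values_lt_exp n w : w < (D ^+ n)%R -> poly_values n w.
Proof.
move=> /lt_exp_prod[s [ss sD sE]].
have := @poly_values_monic n _ (monic_prod_XsubC s xpredT id) _ (coefs_below_prod _ sD).
rewrite size_prod_XsubC ss -sE => /(_ erefl).
by rewrite addrAC subrr add0r.
Qed.

Lemma poly_values_split n u : poly_values n.+1 u ->
  exists c v, [/\ c < D, poly_values n v & u = (c * D ^+ n + v)%R].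
Proof.
move=> [p [sp pD ->]]; exists (p`_n)%R, ((p - p`_n *: 'X^n).[D])%R.
split=> //; last by rewrite hornerD hornerN hornerZ hornerXn addrC subrK.
exists (p - p`_n *: 'X^n)%R; split=> //; last first.
  by apply: coefs_belowB => //; apply: coefs_belowZ => //; exact: coefs_belowXn.
apply/leq_sizeP => j; rewrite leq_eqVlt => /predU1P[<-|nj].
  by rewrite coefB coefZ coefXn eqxx mulr1 subrr.
rewrite coefB coefZ coefXn gtn_eqF// mulr0 subr0 nth_default//.
exact: leq_trans sp nj.
Qed.

(** Write [u = c * D ^+ n + v]. Lowering [v] is covered by induction; lowering [c * D ^+ n] gives
    [c' * D ^+ n + c * d + c' * d] with [c' < c] and [d < D ^+ n], where [d] is a value of degree
    below [n] by [poly_values_lt_exp]. *)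
Lemma poly_values_initial n u w : poly_values n u -> w < u -> poly_values n w.
Proof.
elim: n u w => [|n IH] u w.
  by move=> [p [+ _ ->]]; rewrite leqn0 size_poly_eq0 => /eqP ->; rewrite horner0 ltord0.
move=> /poly_values_split[c [v [cD vV ->]]] /lt_add_ord[[x xc ->]|[y yv ->]].
  have [c' [d [c'c /poly_values_lt_exp dV ->]]] := lt_mul_ord _ _ _ xc.
  have c'D := lt_trans c'c cD.
  apply: poly_valuesD; last exact: poly_valuesS.
  do 2![apply: poly_valuesD; last exact/poly_valuesS/poly_valuesZ].
  exact/poly_valuesZ/poly_values_exp.
apply: poly_valuesD; last exact/poly_valuesS/(IH v).
exact/poly_valuesZ/poly_values_exp.
Qed.

Hypothesis Dtrans : forall p, coefs_below p -> (p.[D] = 0)%R -> p = 0%R.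

Lemma coefs_below_inj p q :
  coefs_below p -> coefs_below q -> (p.[D] = q.[D])%R -> p = q.
Proof.
move=> pD qD e; apply/subr0_eq/Dtrans; first exact: coefs_belowB.
by rewrite hornerD hornerN e subrr.
Qed.

Lemma exp_notin_poly_values n : ~ poly_values n (D ^+ n)%R.
Proof.
move=> [p [sp pD e]].
have /(coefs_below_inj _ _ (coefs_belowXn n) pD) pE : (('X^n).[D] = p.[D])%R.
  by rewrite hornerXn.
by move: sp; rewrite -pE size_polyXn ltnn.
Qed.

Lemma monic_has_root n f : f \is monic -> size f = n.+2 -> coefs_below f ->
  exists2 x, x < D & root f x.
Proof.
move=> fm fs fD; have uV := poly_values_monic _ _ fm fs fD.
have [Du|uD] := leP (D ^+ n.+1)%R (f.[D] - D ^+ n.+1)%R.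
  exfalso; apply: (@exp_notin_poly_values n.+1); move: Du.
  by rewrite le_eqVlt => /predU1P[->//|]; exact: poly_values_initial uV.
have [s [ss sD]] := lt_exp_prod _ _ uD; rewrite addrC subrK => e.
have fE := coefs_below_inj _ _ fD (coefs_below_prod _ sD) e.
(* The degree [n.+1] is positive, so there is at least one linear factor. *)
case: s ss sD fE {e} => // x s _ sD ->; exists x; first by apply: sD; rewrite mem_head.
by rewrite rootE big_cons hornerM hornerXsubC subrr mul0r.
Qed.

(** Since [a * D] is neither [0] nor [1], it exceeds [1], so [1 = a' * D + a * d + a' * d] with
    [a' < a] and [d < D]. If [a' = 0], then [d] inverts [a]. Otherwise [a'] has an inverse [b < D]
    by induction, and solving for [D] gives [D = b * (1 + a * d) + d < D]. *)
Lemma below_has_inv a : a < D -> a != 0%R -> exists2 b, b < D & (a * b = 1)%R.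
Proof.
elim/ord_ind: a => a IH aD a0; apply: contrapT => na.
(* Otherwise [D] would be a root of [a *: 'X - 1], whose constant coefficient is nonzero. *)
have aDn1 : (a * D)%R <> 1%R.
  move=> e; have pD : coefs_below (a *: 'X^1 - 'X^0)%R.
    apply: coefs_belowB; last exact: coefs_belowXn.
    by apply: coefs_belowZ => //; exact: coefs_belowXn.
  have /(Dtrans _ pD)/(congr1 (fun p : {poly Ord} => p`_0)%R) :
      ((a *: 'X^1 - 'X^0).[D] = 0)%R by rewrite !hornerE e subrr.
  rewrite coefB coefZ !coefXn mulr0 sub0r coef0 ord_oppr.
  by apply/eqP; exact: ord1_neq0.
have [|l|//] := ltgtP (a * D)%R 1%R.
  rewrite ord_lt1 => /eqP/ord_mulf_eq0[/eqP|D00]; first by rewrite (negbTE a0).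
  by move: D0; rewrite D00 ltxx.
have [a' [d [a'a dD]]] := lt_mul_ord _ _ _ l.
have [->|a'0] := eqVneq a' 0%R.
  by rewrite !mul0r add0r addr0 => e; apply: na; exists d.
have [b bD ab] := IH _ a'a (lt_trans a'a aD) a'0 => e.
suff : D < D by rewrite ltxx.
have {1}-> : D = (b * (1 + a * d) + d)%R; last first.
  by apply: DD => //; do ?[apply: DM|apply: DD].
have -> : (1 + a * d = a' * (D + d))%R.
  by rewrite e mulrDr; apply: ord_addr_eq0; ring_pair_off.
by rewrite mulrA [(b * _)%R]mulrC ab mul1r; apply: ord_addr_eq0; ring_pair_off.
Qed.

Lemma transcendental_of_not_algebraic : transcendental D.
Proof.
split; first split=> //.
- by move=> x xD; exists x => //; exact: ord_addrr.
- exact: below_has_inv.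
(* Scaling by the inverse [b] of the leading coefficient reduces to the monic case. *)
move=> [//|n] c _ cD cn0; have [b bD cb] := below_has_inv _ (cD _ (leqnn _)) cn0.
pose g := (\poly_(i < n.+2) c i)%R.
have gD : coefs_below g.
  by move=> i; rewrite coef_poly; case: ltnP => // /cD.
have gn : (g`_n.+1 = c n.+1)%R by rewrite coef_poly leqnn.
have sf : size (b *: g)%R = n.+2.
  apply/eqP; rewrite eqn_leq (leq_trans (size_scale_leq _ _) (size_poly _ _)) /=.
  rewrite ltnNge; apply/negP => /leq_sizeP/(_ _ (leqnn _)).
  by rewrite coefZ gn mulrC cb; apply/eqP; exact: ord1_neq0.
have fm : (b *: g)%R \is monic.
  by rewrite monicE lead_coefE sf /= coefZ gn mulrC cb.
have [x xD /eqP gx] := monic_has_root _ _ fm sf (coefs_belowZ _ _ bD gD).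
exists x => //; rewrite nim_evalE -/g -[LHS]mul1r -cb -mulrA -hornerZ gx mulr0.
by [].
Qed.

End SimplestExtension.

(** * Closing off below omega1 *)

Lemma countable_sub {T : Type} (A B : set T) :
  A `<=` B -> countable B -> countable A.
Proof. by move=> AB; apply: sub_countable; exact: subset_card_le. Qed.

Lemma countable_image {T U : Type} (f : T -> U) (A : set T) :
  countable A -> countable (f @` A).
Proof. by apply: sub_countable; exact: card_image_le. Qed.

Lemma countable_setU {T : Type} (A B : set T) :
  countable A -> countable B -> countable (A `|` B)%classic.
Proof.
by move=> cA cB; rewrite -bigcup2E; apply: bigcup_countable => // -[|[|i]].
Qed.

Lemma countable_seqs (A : set Ord) : countable A ->
  countable [set s : seq Ord | forall x, x \in s -> A x].
Proof.
move=> /countable_injP[f fI]; apply/countable_injP.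
exists (fun s => pickle (map f s)) => s t /set_mem hs /set_mem ht.
move=> /(pcan_inj pickleK); apply: (inj_in_map fI); apply/allP => x.
  by move=> /hs ?; apply/mem_set.
by move=> /ht ?; apply/mem_set.
Qed.

(** A root splits off a linear factor; without zero divisors, every other root of [p] is a root of
    the quotient, which has smaller size. *)
Lemma countable_roots (p : {poly Ord}) : p != 0%R -> countable [set x | root p x].
Proof.
have [n] := ubnP (size p); elim: n p => // n IH p pn p0.
have [[a pa]|np] := pselect (exists a, root p a); last first.
  by apply: (countable_sub _ set0) => [x px|]; [apply: np; exists x|exact: countable0].
have /factor_theorem[q pE] := pa.
have q0 : q != 0%R by apply: contra_neq p0 => q0; rewrite pE q0 mul0r.
have qn : (size q < n)%N.
  by move: pn; rewrite pE size_Mmonic ?monicXsubC// size_XsubC addn2 ltnS.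
apply: (countable_sub _ (a |` [set x | root q x])%classic).
  move=> x /=; rewrite pE => /eqP; rewrite hornerM hornerXsubC.
  by move=> /ord_mulf_eq0[/eqP|/subr0_eq]; [right|left].
by apply: countable_setU; [exact: countable1|exact: IH].
Qed.

Lemma lt_omega1 (a : Ord) : (a < omega1) <-> countable (below a).
Proof.
have [no le] := omega1_spec; split=> [lt|ca].
  by apply: contrapT => /le; rewrite leNgt lt.
rewrite ltNge; apply/negP => h; apply: no; apply: countable_sub ca => x xo.
exact: lt_le_trans xo h.
Qed.

Lemma countable_setC (S : set Ord) : countable S -> ~` S !=set0.
Proof.
move=> cS; have [no _] := omega1_spec; apply: contrapT => S0; apply: no.
apply: countable_sub cS => x _; apply: contrapT => nx; apply: S0.
by exists x.
Qed.

Lemma mex_lt_omega1 (S : set Ord) : countable S -> mex S < omega1.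
Proof.
move=> cS; apply/lt_omega1; have [_ h] := mexP _ (countable_setC _ cS).
exact: countable_sub cS.
Qed.

Lemma add_lt_omega1 (a b : Ord) :
  a < omega1 -> b < omega1 -> (a + b)%R < omega1.
Proof.
move=> /lt_omega1 ca /lt_omega1 cb; apply/lt_omega1.
apply: (countable_sub _ ([set (x + b)%R | x in below a] `|`
                         [set (a + y)%R | y in below b])%classic).
  by move=> c /lt_add_ord[[x xa ->]|[y yb ->]]; [left; exists x|right; exists y].
by apply: countable_setU; exact: countable_image.
Qed.

Lemma mul_lt_omega1 (a b : Ord) :
  a < omega1 -> b < omega1 -> (a * b)%R < omega1.
Proof.
move=> /lt_omega1 ca /lt_omega1 cb; apply/lt_omega1.
apply: (countable_sub _ [set (z.1 * b + a * z.2 + z.1 * z.2)%R |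
                         z in (below a `*` below b)%classic]).
  by move=> c /lt_mul_ord[x [y [xa yb ->]]]; exists (x, y).
by apply: countable_image; exact: countableX.
Qed.

Lemma one_lt_omega1 : (1 : Ord)%R < omega1.
Proof. exact: mex_lt_omega1 (countable1 _). Qed.

(** Regularity of [omega1]: the bound is the [mex] of the downward closure of [X], a countable union
    of countable sets. *)
Lemma countable_ub (X : set Ord) : countable X -> X `<=` below omega1 ->
  exists2 b, b < omega1 & forall x, X x -> x < b.
Proof.
move=> cX Xo; pose Y := \bigcup_(x in X) (x |` below x)%classic.
have cY : countable Y.
  apply: bigcup_countable => // x /Xo/lt_omega1 cx.
  by apply: countable_setU => //; exact: countable1.
have [nY _] := mexP _ (countable_setC _ cY).
exists (mex Y); first exact: mex_lt_omega1.
move=> x Xx; rewrite ltNge; apply/negP; rewrite le_eqVlt => h.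
by apply: nY; exists x => //; case/predU1P: h; [left|right].
Qed.

(** The ordinal [a] is the supremum of an increasing sequence [B n], where [B n.+1] bounds [G s] for
    all lists [s] below [B n]. A list is finite, so if it lies below [a] it lies below some
    [B n]. *)
Lemma closing_off (G : seq Ord -> set Ord) (b : Ord) :
  (forall s, countable (G s)) -> (forall s, G s `<=` below omega1) ->
  b < omega1 -> exists a, [/\ b <= a, a < omega1
    & forall s, (forall x, x \in s -> x < a) -> G s `<=` below a].
Proof.
move=> cG Go bo.
have step c : exists c', c < omega1 -> [/\ c < c', c' < omega1
    & forall s, (forall x, x \in s -> x < c) -> G s `<=` below c'].
  (* The witness [c] is arbitrary here; it only makes the relation total for [choice]. *)
  have [co|co] := pselect (c < omega1); last by exists c.
  have [||c' c'o cc'] := @countable_ub (c |` \bigcup_(s in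
      [set s : seq Ord | forall x, x \in s -> below c x]) G s)%classic.
  - apply: countable_setU; first exact: countable1.
    by apply: bigcup_countable => //; apply: countable_seqs; exact/lt_omega1.
  - by move=> x [->//|[s _]]; exact: Go.
  exists c' => _; split=> //; first by apply: cc'; left.
  by move=> s sc x Gx; apply: cc'; right; exists s.
have [h hP] := choice step; pose B n := iter n h b.
have Bo n : B n < omega1 by elim: n => //= n /hP[].
have Bm m n : (m <= n)%N -> B m <= B n.
  move=> /subnK <-; elim: (n - m)%N => //= k /le_trans; apply.
  by have [/ltW] := hP _ (Bo (k + m)%N).
pose Y := \bigcup_(n in [set: nat]) below (B n).
have cY : countable Y.
  by apply: bigcup_countable => // n _; exact/lt_omega1.
have [nY ltY] := mexP _ (countable_setC _ cY).
have Ylt n x : x < B n -> x < mex Y.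
  move=> xB; rewrite ltNge; apply/negP => yx; apply: nY; exists n => //.
  exact: le_lt_trans yx xB.
exists (mex Y); split; last 2 first.
- exact: mex_lt_omega1.
- move=> s sY x Gx.
  have [n sB] : exists n, forall x, x \in s -> x < B n.
    elim: s sY {Gx} => [|y s IH] sY; first by exists 0%N.
    have [|m sB] := IH; first by move=> z zs; apply: sY; rewrite in_cons zs orbT.
    have [k _ yk] := ltY _ (sY y (mem_head _ _)).
    exists (maxn k m) => z; rewrite in_cons => /predU1P[->|/sB zm].
      exact: lt_le_trans yk (Bm _ _ (leq_maxl _ _)).
    exact: lt_le_trans zm (Bm _ _ (leq_maxr _ _)).
  have [_ _ /(_ _ sB _ Gx)] := hP _ (Bo n).
  exact: (Ylt n.+1).
rewrite leNgt; apply/negP => l; apply: nY; exists 0%N => //.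
Qed.

Lemma transcendental_cofinal (b : Ord) : b < omega1 ->
  exists2 a, b <= a & a < omega1 /\ transcendental a.
Proof.
(* A list serves both as a pair of operands, its first two entries, and as the coefficients of a
   polynomial. Restricting to [x < omega1] still catches [a] itself, the only root to be
   excluded. *)
pose G (s : seq Ord) : set Ord := [set x | x < omega1 /\
  ([set 1%R; (s`_0 + s`_1)%R; (s`_0 * s`_1)%R] x \/ (Poly s != 0 /\ root (Poly s) x)%R)].
have cG s : countable (G s).
  apply: (@countable_sub _ _ ([set 1%R; (s`_0 + s`_1)%R; (s`_0 * s`_1)%R] `|`
     [set x | Poly s != 0 /\ root (Poly s) x])%R%classic).
    by move=> x [_].
  apply: countable_setU.
    by do ![apply: countable_setU]; exact: countable1.
  have [->|s0] := eqVneq (Poly s) 0%R.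
    by apply: (countable_sub _ set0) => [x [] //|]; exact: countable0.
  by apply: countable_sub (countable_roots _ s0) => x [].
have Go s : G s `<=` below omega1 by move=> x [].
move=> /(closing_off _ _ cG Go)[a [ba ao aG]]; exists a => //; split=> //.
have pair_lt x y : x < a -> y < a -> forall z, z \in [:: x; y] -> z < a.
  by move=> xa ya z; rewrite in_cons mem_seq1 => /orP[] /eqP ->.
apply: transcendental_of_not_algebraic.
- apply: (aG [::]) => //; split; first exact: one_lt_omega1.
  by left; left; left.
- move=> x y xa ya; apply: (aG _ (pair_lt _ _ xa ya)).
  split; first by apply: add_lt_omega1; exact: lt_trans ao.
  by left; left; right.
- move=> x y xa ya; apply: (aG _ (pair_lt _ _ xa ya)).
  split; first by apply: mul_lt_omega1; exact: lt_trans ao.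
  by left; right.
- move=> p pa pa0; apply/eqP; apply: contrapT => /negP p0.
  suff : a < a by rewrite ltxx.
  apply: (aG p) => [x /(nthP 0%R)[i _ <-]|]; first exact: pa.
  by split=> //; right; rewrite polyseqK; split=> //; apply/eqP.
Qed.

(** * Order types of unbounded subsets of [omega1] *)

(** Transfinite recursion sends [b] to the least element of [S] above all earlier values. For
    [b < omega1] these values form a countable set, bounded below [omega1], so such an element
    exists. *)
Lemma cofinal_order_type_omega1 (S : set Ord) : S `<=` below omega1 ->
  (forall b, b < omega1 -> exists2 a, b <= a & S a) -> has_order_type S omega1.
Proof.
move=> So Scof.
pose f := Fix ord_lt_wf (fun _ => Ord) (fun b f =>
  least [set s | S s /\ forall c (h : c < b), f c h < s]).
have fE b : f b = least [set s | S s /\ forall c, c < b -> f c < s].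
  by rewrite /f ord_FixE.
have fleast b : b < omega1 -> [/\ S (f b), forall c, c < b -> f c < f b
    & forall s, S s -> (forall c, c < b -> f c < s) -> f b <= s].
  elim/ord_ind: b => b IH bo; rewrite (fE b).
  have [|[Sl lt] le] := @leastP [set s | S s /\ forall c, c < b -> f c < s].
    have [||u uo ub] := countable_ub (f @` below b).
    - by apply: countable_image; exact/lt_omega1.
    - by move=> _ [c cb <-]; apply: So; have [] := IH _ cb (lt_trans cb bo).
    have [s us Ss] := Scof _ uo; exists s; split=> // c cb.
    by apply: lt_le_trans us; apply: ub; exists c.
  by split=> // s Ss sub; exact: le.
have fm a b : below omega1 a -> below omega1 b -> a < b -> f a < f b.
  by move=> _ /fleast[_ + _]; apply.
have fo a : below omega1 a -> below omega1 (f a) by move=> /fleast[/So].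
exists f; last first.
  move=> b c bo co; have [bc|cb|->] := ltgtP b c; last by rewrite ltxx.
    by rewrite fm.
  by apply/negbTE; rewrite -leNgt ltW// fm.
split.
- by move=> b /fleast[].
- move=> b c /set_mem bo /set_mem co e; have [bc|cb|//] := ltgtP b c.
    by have := fm _ _ bo co bc; rewrite e ltxx.
  by have := fm _ _ co bo cb; rewrite e ltxx.
(* For surjectivity, [s] is the value of [f] at the least [b] with [s <= f b]; one exists because
   [s <= f s], and all earlier values are below [s], so [f b <= s]. *)
move=> s Ss; have [|[bo sb] bmin] := @leastP [set b | b < omega1 /\ s <= f b].
  by exists s; split; [exact: So|apply: (mono_ge _ _ fo fm); exact: So].
exists (least [set b | b < omega1 /\ s <= f b]) => //.
apply/eqP; rewrite eq_le sb andbT.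
have [_ _] := fleast _ bo; apply=> // c cb; rewrite ltNge; apply/negP => sc.
have /bmin : c < omega1 /\ s <= f c by split=> //; exact: lt_trans bo.
by rewrite leNgt cb.
Qed.

Theorem proposition3p7 :
  has_order_type [set a : Ord | a < omega1 /\ transcendental a] omega1.
Proof.
apply: cofinal_order_type_omega1; first by move=> a [].
exact: transcendental_cofinal.
Qed.
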